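(* Let $Y \subset \mathbb{P}W$ be an irreducible cubic hypersurface with nonzero Hessian defined by a cubic form $f \in \mathrm{Sym}^3 W^*$. Assume that there exists a nonzero $A \in \mathfrak{aut}(\widehat{Y})^{(1)}$ of the form $$A_{uv} = a\,\chi^A(u)\,v + a\,\chi^A(v)\,u + h(f_{uv}) \quad \text{for all } u,v \in W,$$ for some $h \in \mathrm{Hom}(W^*,W)$ and some $a \in \mathbb{C}$ with $a \neq \frac{1}{4}$. Then the secant variety of $\mathrm{Sing}(Y)$ coincides with the cubic hypersurface $Y$.
   Context: Everything is over $\mathbb{C}$; vector spaces are finite-dimensional; $\mathbb{P}W$ is the space of one-dimensional subspaces of $W$. A cubic form $f \in \mathrm{Sym}^3 W^*$ is identified with a symmetric trilinear form $f(u,v,w)$ on $W$. The irreducible (reduced) cubic hypersurface $Y$ is defined by an irreducible $f$: its affine cone is $\widehat{Y} = \{w \in W : f(w,w,w)=0\}$. For $u,v \in W$, $f_{uv} \in W^*$ is the functional $f_{uv}(w) = f(u,v,w)$. $Y$ has nonzero Hessian if there exists $w \in W$ such that $f_{wv} \neq 0$ for every nonzero $v \in W$ (equivalently, this holds for a general $w$). $\mathrm{Sing}(Y)$ is the (reduced) set of singular points of $Y$. $\mathfrak{aut}(\widehat{Y}) \subset \mathrm{End}(W)$ is the Lie algebra of endomorphisms $\varphi$ such that $\varphi(w)$ lies in the affine tangent space $T_w\widehat{Y} \subset W$ for every nonsingular point $w$ of $\widehat{Y}$; equivalently, there is a (unique) scalar $\chi(\varphi) \in \mathbb{C}$ with $f(\varphi(u),v,w)+f(u,\varphi(v),w)+f(u,v,\varphi(w))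 = \chi(\varphi) f(u,v,w)$ for all $u,v,w \in W$. For a symmetric bilinear map $A \in \mathrm{Hom}(S^2W,W)$ write $A_{uv}=A_{vu} \in W$ for its value at $(u,v)$ and $A_w \in \mathrm{End}(W)$ for $A_w(u)=A_{wu}$. Then $\mathfrak{aut}(\widehat{Y})^{(1)}$ is the space of all $A$ with $A_w \in \mathfrak{aut}(\widehat{Y})$ for every $w \in W$. For such $A$, $\chi^A \in W^*$ is defined by $\chi^A(w) = \chi(A_w)$. For an algebraic subset $Z \subset \mathbb{P}W$, the secant variety $\mathrm{Sec}(Z)$ is the closure of the union of the lines joining pairs of distinct points of $Z$. *)

(* Defs.v *)
Set Warnings "-notation-overridden,-ambiguous-paths,-notation-incompatible-prefix".
From HB Require Import structures.
From mathcomp Require Import all_boot all_order all_algebra.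
From mathcomp Require Import complex mpoly.
From mathcomp Require Import classical_sets reals.

Set Implicit Arguments.
Unset Strict Implicit.
Unset Printing Implicit Defensive.

Import GRing.Theory.

Local Open Scope ring_scope.
Local Open Scope complex_scope.
Local Open Scope classical_set_scope.

Definition dual (K : fieldType) (W : vectType K) := 'Hom(W, K^o).

(* Sym^3 W^*, as symmetric trilinear forms *)
Record cubicForm (K : fieldType) (W : vectType K) := CubicForm {
  trilinear_of :> W -> W -> W -> K;
  cubicC12 : forall u v w, trilinear_of u v w = trilinear_of v u w;
  cubicC23 : forall u v w, trilinear_of u v w = trilinear_of u w v;
  cubic_linear : forall u v, linear (trilinear_of u v : W -> K^o) }.

Section Projective.
Variables (R : realType) (W : vectType R[i]).

(* Polynomial functions on W are written in the coordinates of a fixed basis;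
   none of the notions below depends on its choice. *)
Definition coordinates (w : W) : 'I_(\dim {:W}) -> R[i] :=
  fun i => coord (vbasis {:W}) i w.

Definition projSpace := {L : {vspace W} | \dim L == 1%N}.

Definition vanishes_at (p : {mpoly R[i][\dim {:W}]}) (L : projSpace) :=
  forall w, w \in val L -> p.@[coordinates w] = 0.

Definition zariski_closure (Z : set projSpace) : set projSpace :=
  [set L | forall (d : nat) (p : {mpoly R[i][\dim {:W}]}),
     p \is d.-homog -> (forall M, Z M -> vanishes_at p M) -> vanishes_at p L].

Definition secant_variety (Z : set projSpace) : set projSpace :=
  zariski_closure [set L | exists M N : projSpace,
    [/\ Z M, Z N, M != N & (val L <= val M + val N)%VS]].

End Projective.

Definition irreducible_elt (D : idomainType) (p : D) :=
  [/\ p != 0, p \isn't a GRing.unit &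
      forall q r : D,
        p = q * r -> q \is a GRing.unit \/ r \is a GRing.unit].

Section Cubic.
Variables (R : realType) (W : vectType R[i]) (f : cubicForm W).

HB.instance Definition _ (u v : W) :=
  GRing.isLinear.Build R[i] W (R[i])^o _ (f u v : W -> (R[i])^o)
    (cubic_linear f u v).

(* f_{uv} *)
Definition contract (u v : W) : dual W := linfun (f u v : W -> (R[i])^o).

Lemma contractE (u v w : W) : contract u v w = f u v w.
Proof. exact: lfunE. Qed.

Definition cubic_poly : {mpoly R[i][\dim {:W}]} :=
  let e := vbasis {:W} in
  \sum_(i < \dim {:W}) \sum_(j < \dim {:W}) \sum_(k < \dim {:W})
    f e`_i e`_j e`_k *: ('X_i * 'X_j * 'X_k).

Lemma cubic_polyE (w : W) : cubic_poly.@[coordinates w] = f w w w.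
Proof.
have flin2 (u w' : W) : linear (fun v => f u v w' : (R[i])^o).
  by move=> c x y; rewrite ![f u _ w']cubicC23 linearP.
have flin1 (v w' : W) : linear (fun u => f u v w' : (R[i])^o).
  by move=> c x y; rewrite ![f _ v w']cubicC12 flin2.
have fsum1 (v w' : W) (I : finType) (c : I -> R[i]) (x : I -> W) :
    f (\sum_i c i *: x i) v w' = \sum_i c i * f (x i) v w'.
  pose g := GRing.isLinear.Build _ _ _ _ _ (flin1 v w').
  pose G : {linear W -> (R[i])^o} := HB.pack (fun u => f u v w' : (R[i])^o) g.
  rewrite -[LHS]/(G _) linear_sum; apply: eq_bigr => i _.
  by rewrite linearZ.
have wE : w = \sum_i coordinates w i *: (vbasis {:W})`_i.
  exact: coord_vbasis (memvf w).
rewrite {2 3 4}wE fsum1 /cubic_poly raddf_sum; apply: eq_bigr => i _ /=.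
rewrite cubicC12 fsum1 raddf_sum mulr_sumr; apply: eq_bigr => j _ /=.
rewrite cubicC23 cubicC12 fsum1 raddf_sum !mulr_sumr; apply: eq_bigr => k _ /=.
rewrite mevalZ !mevalM !mevalXU [f _`_k _ _]cubicC12 [f _`_j _ _]cubicC23.
rewrite [f _`_j _ _]cubicC12 mulrC -!mulrA; congr (_ * (_ * (_ * _))).
Qed.

Definition hypersurface : set (projSpace W) :=
  [set L : projSpace W | forall w, w \in val L -> f w w w = 0].

Definition nonzero_hessian :=
  exists w, forall v, v != 0 -> contract w v != 0.

Definition affine_cone : set W := [set w | f w w w = 0].

(* Jacobian criterion; cubic_poly generates the ideal of the cone when it is
   irreducible. *)
Definition cone_singular (w : W) :=
  affine_cone w /\ forall i, (cubic_poly^`M(i)).@[coordinates w] = 0.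

Definition Sing : set (projSpace W) :=
  [set L : projSpace W | forall w, w \in val L -> cone_singular w].

Definition affine_tangent (w : W) : set W :=
  [set v | \sum_i (cubic_poly^`M(i)).@[coordinates w] * coordinates v i = 0].

Definition aut_cone : set 'End(W) :=
  [set phi | forall w, affine_cone w -> ~ cone_singular w ->
     affine_tangent w (phi w)].

Definition is_character (phi : 'End(W)) (c : R[i]) :=
  forall u v w, f (phi u) v w + f u (phi v) w + f u v (phi w) = c * f u v w.

(* chi(phi), with the junk value 0 when no such scalar exists, which does not
   happen for phi in aut_cone when cubic_poly is irreducible *)
Definition character (phi : 'End(W)) : R[i] := xget 0 (is_character phi).

(* A bilinear map is curried: A u v is A_{uv} and A u is A_u. *)
Definition aut_prolongation : set 'Hom(W, 'End(W)) :=
  [set A : 'Hom(W, 'End(W)) | (forall u v, A u v = A v u) /\ forall w, aut_cone (A w)].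

End Cubic.

(* Main.v *)
Require Import Defs.
From mathcomp Require Import all_boot all_order all_algebra.
From mathcomp Require Import complex mpoly.
From mathcomp Require Import boolp classical_sets reals.
From mathcomp Require Import zify ring.

(** Write [F w = f w w w] and [chi w] for the character of [A_w].  Inserting
    the prescribed shape of [A] into the identity that defines the character
    gives a quadrilinear relation between [f], [chi] and [h], with a parameter
    [a] ([prolongation_identity]).

    Its skew part says that [1 - 2a] times a rank-two expression in [chi] and
    [f] is the skew part of the bilinear form that [h] defines on the dual
    space.  The latter does not depend on the point at which [f] is contracted,
    and moving that point forces [a = 1/2] as soon as [chi] is nonzero
    ([prolongation_coef]).  If [chi = 0] the value of [a] is immaterial, so
    [a = 1/2] may be assumed in all cases; then [h] is symmetric.

    Consider now the quadratic map [z w = 2 h(f_ww) + chi(w) w], called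
    [kernel_field] below.  The relation yields

      [3 f(w, z, _) = - F(w) chi]   everywhere,
      [f(z, z, _) = - chi(z) f(w, w, _)]   on [Y].

    The first identity and the Hessian hypothesis exclude [chi = 0].  On [Y] it
    says that [z w] lies in the kernel of [f_w], so that
    [f_{w+tz, w+tz} = (1 - t^2 chi(z)) f_ww]: with [t^2 = 1/chi(z)] both
    [w + tz] and [w - tz] are singular points, and [w] is on the secant that
    joins them ([conic_secant]).

    This needs [chi(z) <> 0] for general [w] in [Y].  Otherwise the quadratic
    form [chi(z)] vanishes on [Y], hence identically; with [c = h(chi)] this
    reads [2 f(w, c, _) = - chi(w) chi], and comparison with the first identity
    gives [3 chi(w) z(w) = 2 F(w) c] for general [w].  Then [chi] divides [F]
    ([character_kernel_field_neq0]), against irreducibility.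

    The passage from general points of [Y] to all of them uses that the
    polynomials vanishing on [Y] form the prime ideal generated by the cubic.
    This is proved without unique factorisation in several variables: on the
    lines in a fixed direction [p] with [F p = 1] the cubic becomes a monic
    cubic in one variable over a polynomial ring.  A factor of it over the
    fraction field would give a rational root; a rational root that is integral
    is affine along lines, so its differential produces a hyperplane on which
    [F] vanishes ([no_rational_root]).  Irreducibility over the fraction field
    then makes the resultant with any other polynomial either nonzero, or
    explained by divisibility ([dvd_or_generically_nonzero]). *)

Set Implicit Arguments.
Unset Strict Implicit.
Unset Printing Implicit Defensive.

Import Order.TTheory GRing.Theory Num.Theory.

Local Open Scope ring_scope.
Local Open Scope complex_scope.

(** * Polynomials along a direction *)

Section PolynomialFunctions.
Variables (n : nat) (K : numFieldType).
Implicit Types (G : {mpoly K[n]}) (q v : 'I_n -> K) (t : K).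

(** Suited to identities between ring morphisms and derivations, which are
    determined by constants and variables. *)
Lemma mpoly_ring_ind (P : {mpoly K[n]} -> Prop) :
  (forall c, P c%:MP) -> (forall i, P 'X_i) ->
  (forall G H, P G -> P H -> P (G + H)) ->
  (forall G H, P G -> P H -> P (G * H)) -> forall G, P G.
Proof.
move=> PC PX PD PM; elim/mpolyind => [|c m p _ _ IHp]; first exact: PC 0.
apply: (PD) => //; rewrite -mul_mpolyC; apply: (PM) => //.
rewrite mpolyXE_id; apply: (big_ind P) => [||i _].
- exact: (PC 1).
- exact: (PM).
- elim: (m i) => [|k IHk]; rewrite ?expr0 ?exprS; last exact: (PM).
  exact: (PC 1).
Qed.

(** The substitution [q |-> q + t v], as a polynomial in [t] with polynomial
    coefficients in [q].  It is locked because conversion would otherwise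
    unfold and compare the underlying sums over monomials. *)
Fact shear_key : unit. Proof. exact: tt. Qed.
Definition shear v : {mpoly K[n]} -> {poly {mpoly K[n]}} :=
  locked_with shear_key
    (mmap (polyC \o @mpolyC n K) (fun i => ('X_i)%:P + (v i)%:MP *: 'X)).
Canonical shear_unlockable v := [unlockable of shear v].

Lemma shearD v : {morph shear v : G H / G + H}.
Proof. rewrite unlock; exact: mmapD. Qed.

Lemma shearM v : {morph shear v : G H / G * H}.
Proof.
rewrite unlock; 
exact: (@mmap_is_multiplicative n K _ _ (polyC \o @mpolyC n K)).1.
Qed.

Lemma shearC v c : shear v c%:MP = (c%:MP)%:P.
Proof. rewrite unlock; exact: mmapC. Qed.

Lemma shearX v i : shear v 'X_i = ('X_i)%:P + (v i)%:MP *: 'X.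
Proof. by rewrite unlock mmapX mmap1U. Qed.

Lemma horner_shear v q t G :
  (map_poly (meval q) (shear v G)).[t] = G.@[fun i => q i + t * v i].
Proof.
elim/mpoly_ring_ind: G => [c|i|G H IHG IHH|G H IHG IHH].
- by rewrite shearC map_polyC hornerC [LHS]mevalC mevalC.
- rewrite shearX rmorphD /= map_polyC map_polyZ map_polyX !hornerE /=.
  by rewrite !mevalXU mevalC mulrC.
- by rewrite shearD (rmorphD (map_poly (meval q))) hornerD mevalD -IHG -IHH.
- by rewrite shearM (rmorphM (map_poly (meval q))) hornerM mevalM -IHG -IHH.
Qed.

Lemma coef0_shear v G : (shear v G)`_0 = G.
Proof.
elim/mpoly_ring_ind: G => [c|i|G H IHG IHH|G H IHG IHH].
- by rewrite shearC coefC.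
- by rewrite shearX coefD coefC coefZ coefX mulr0 addr0.
- by rewrite shearD coefD IHG IHH.
- by rewrite shearM coef0M IHG IHH.
Qed.

(** The first order term is the derivative in the direction [v]; in particular
    it is linear in [v]. *)
Lemma coef1_shear v G : (shear v G)`_1 = \sum_i v i *: G^`M(i).
Proof.
elim/mpoly_ring_ind: G => [c|i|G H IHG IHH|G H IHG IHH].
- by rewrite shearC coefC big1 // => i _; rewrite mderivC scaler0.
- rewrite shearX coefD coefC coefZ coefX add0r mulr1 (bigD1 i) //= mderivX.
  rewrite mnmE eqxx scale1r.
  have -> : (U_(i) - U_(i) = 0)%MM.
    by apply/mnmP => j; rewrite mnmBE mnm0E subnn.
  rewrite mpolyX0 big1 ?addr0 => [|j jNi].
    by rewrite -mul_mpolyC mulr1.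
  by rewrite mderivX mnmE eq_sym (negPf jNi) scale0r scaler0.
- rewrite shearD coefD IHG IHH -big_split; apply: eq_bigr => i _.
  by rewrite mderivD scalerDr.
- rewrite shearM coefM big_ord_recl big_ord1 /= !coef0_shear IHG IHH.
  rewrite mulr_suml mulr_sumr -big_split; apply: eq_bigr => i _ /=.
  by rewrite mderivM scalerDr -scalerAl -scalerAr addrC.
Qed.

Lemma poly_horner_inj (p r : {poly K}) : (forall t, p.[t] = r.[t]) -> p = r.
Proof.
move=> pr; apply/eqP; rewrite -subr_eq0; apply/negP => /negP pr_neq0.
have := max_poly_roots (rs := [seq i%:R | i <- iota 0 (size (p - r))]) pr_neq0.
rewrite size_map size_iota ltnn => H; apply/notF/H.
  by apply/allP => x _; rewrite /root hornerD hornerN pr subrr.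
by rewrite map_inj_uniq ?iota_uniq // => i j /eqP; rewrite eqr_nat => /eqP.
Qed.

(** All the partial derivatives of a polynomial that vanishes everywhere vanish
    everywhere too, so in characteristic zero every coefficient can be brought
    down to the constant one. *)
Lemma mpoly_meval_eq0 G : (forall q, G.@[q] = 0) -> G = 0.
Proof.
move=> G0; apply/mpolyP => m; rewrite mcoeff0.
have [k] := ubnP (mdeg m); elim: k => // k IHk in m G G0 * => m_lt.
have [->|m_neq0] := eqVneq m 0%MM.
  rewrite -(G0 (fun=> 0)); elim/mpoly_ring_ind: G {G0} => //.
  - by move=> c; rewrite mcoeffC eqxx mulr1 mevalC.
  - move=> i; rewrite mevalXU mcoeffX; case: eqP => // /(congr1 (@mdeg n)).
    by rewrite mdeg1 mdeg0.
  - by move=> G H; rewrite mcoeffD mevalD => -> ->.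
  - by move=> G H; rewrite (rmorphM (mcoeff 0%MM)) mevalM /= => -> ->.
have [i m_gt0] : exists i, (0 < m i)%N.
  apply/existsP; apply: contraR m_neq0 => /existsPn m0; apply/eqP/mnmP => i.
  by rewrite mnm0E; have := m0 i; case: (m i).
have mE : m = (m - U_(i) + U_(i))%MM by rewrite submK // lep1mP -lt0n.
move: m_lt; rewrite ltnS {1}mE mdegD mdeg1 addn1 => m_lt.
have dG0 q : G^`M(i).@[q] = 0.
  pose v j : K := (j == i)%:R.
  have := coef1_shear v G => /(congr1 (meval q)).
  rewrite -coef_map raddf_sum (bigD1 i) //= big1 => [|j jNi].
    rewrite addr0 /v eqxx scale1r => <-.
    suff -> : map_poly (meval q) (shear v G) = 0 by rewrite coef0.
    by apply: poly_horner_inj => t; rewrite horner_shear G0 horner0.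
  by rewrite /v (negPf jNi) scale0r meval0.
have /eqP := IHk _ _ dG0 m_lt; rewrite mcoeff_deriv -mE -mulr_natr.
by rewrite mulf_eq0 pnatr_eq0 orbF => /eqP.
Qed.

End PolynomialFunctions.

(** * Polynomial functions on a vector space *)

Section PolynomialFunctionsOnW.
Variables (R : realType) (W : vectType R[i]).
Local Notation C := R[i].
Local Notation n := (\dim {:W}).
Local Notation e := (vbasis {:W}).
Implicit Types (g : W -> C) (u v w : W) (l : dual W).

Lemma coordinatesE w : w = \sum_i coordinates w i *: e`_i.
Proof. exact: coord_vbasis (memvf w). Qed.

Lemma coordinatesK (x : 'I_n -> C) : coordinates (\sum_i x i *: e`_i) =1 x.
Proof.
move=> i; rewrite /coordinates coord_sum_free //.
exact: basis_free (vbasisP _).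
Qed.

Lemma coordinatesD u v i :
  coordinates (u + v) i = coordinates u i + coordinates v i.
Proof. exact: raddfD. Qed.

Lemma coordinatesZ c u i : coordinates (c *: u) i = c * coordinates u i.
Proof. exact: linearZ. Qed.

Lemma meval_coordinates_eq0 (p : {mpoly C[n]}) :
  (forall w, p.@[coordinates w] = 0) -> p = 0.
Proof.
move=> p0; apply: mpoly_meval_eq0 => q.
by rewrite -(meval_eq _ (coordinatesK q)).
Qed.

Definition polyfun g :=
  exists p : {mpoly C[n]}, forall w, g w = p.@[coordinates w].

Lemma polyfun_ext g1 g2 : g1 =1 g2 -> polyfun g1 -> polyfun g2.
Proof. by move=> E [p Hp]; exists p => w; rewrite -E. Qed.

Lemma polyfun_cst c : polyfun (fun=> c).
Proof. by exists c%:MP => w; rewrite mevalC. Qed.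

Lemma polyfunD g1 g2 :
  polyfun g1 -> polyfun g2 -> polyfun (fun w => g1 w + g2 w).
Proof. by move=> [p Hp] [q Hq]; exists (p + q) => w; rewrite mevalD Hp Hq. Qed.

Lemma polyfunM g1 g2 :
  polyfun g1 -> polyfun g2 -> polyfun (fun w => g1 w * g2 w).
Proof. by move=> [p Hp] [q Hq]; exists (p * q) => w; rewrite mevalM Hp Hq. Qed.

Lemma polyfun_sum (I : Type) (r : seq I) (P : pred I) (g : I -> W -> C) :
  (forall i, polyfun (g i)) -> polyfun (fun w => \sum_(i <- r | P i) g i w).
Proof.
move=> Pg; elim: r => [|i r [p Hp]].
  by have [p Hp] := polyfun_cst 0; exists p => w; rewrite big_nil -Hp.
have [q Hq] := Pg i; exists (if P i then q + p else p) => w.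
by rewrite big_cons; case: (P i); rewrite ?mevalD Hp ?Hq.
Qed.

Lemma polyfun_prod (I : Type) (r : seq I) (P : pred I) (g : I -> W -> C) :
  (forall i, polyfun (g i)) -> polyfun (fun w => \prod_(i <- r | P i) g i w).
Proof.
move=> Pg; elim: r => [|i r [p Hp]].
  by have [p Hp] := polyfun_cst 1; exists p => w; rewrite big_nil -Hp.
have [q Hq] := Pg i; exists (if P i then q * p else p) => w.
by rewrite big_cons; case: (P i); rewrite ?mevalM Hp ?Hq.
Qed.

Lemma dualE l w : l w = \sum_i coordinates w i * l e`_i.
Proof.
rewrite {1}(coordinatesE w) linear_sum.
by apply: eq_bigr => i _; rewrite linearZ.
Qed.

Lemma polyfun_dual l : polyfun l.
Proof.
apply: polyfun_ext (fsym (dualE l)) _; apply: polyfun_sum => i.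
apply: polyfunM; last exact: polyfun_cst.
by exists 'X_i => w; rewrite mevalXU.
Qed.

Lemma polyfun_mul_eq0 g1 g2 : polyfun g1 -> polyfun g2 ->
  (forall w, g1 w * g2 w = 0) -> (forall w, g1 w = 0) \/ (forall w, g2 w = 0).
Proof.
move=> [p Hp] [q Hq] pq0.
have /eqP : p * q = 0.
  by apply: meval_coordinates_eq0 => w; rewrite mevalM -Hp -Hq pq0.
by rewrite mulf_eq0 => /orP[] /eqP E; [left | right] => w;
  rewrite ?Hp ?Hq E meval0.
Qed.

Definition coordinate_form i : dual W := linfun (coord e i : W -> C^o).

Lemma coordinate_formE i w : coordinate_form i w = coordinates w i.
Proof. exact: lfunE. Qed.

Lemma separating_dual u : u != 0 -> exists l : dual W, l u != 0.
Proof.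
move=> u_neq0; have [/existsP [i ui]|/existsPn u0] :=
  boolP [exists i, coordinates u i != 0].
  by exists (coordinate_form i); rewrite coordinate_formE.
case/eqP: u_neq0; rewrite (coordinatesE u) big1 // => i _.
by have := u0 i; rewrite negbK => /eqP ->; rewrite scale0r.
Qed.

Definition vpolyfun (x : W -> W) := forall l, polyfun (fun w => l (x w)).

Lemma vpolyfun_id : vpolyfun id.
Proof. exact: polyfun_dual. Qed.

Lemma vpolyfun_cst u : vpolyfun (fun=> u).
Proof. by move=> l; apply: polyfun_cst. Qed.

Lemma vpolyfunD x y : vpolyfun x -> vpolyfun y -> vpolyfun (fun w => x w + y w).
Proof.
move=> Px Py l; apply: polyfun_ext (polyfunD (Px l) (Py l)) => w.
by rewrite linearD.
Qed.

Lemma vpolyfunZ g x : polyfun g -> vpolyfun x -> vpolyfun (fun w => g w *: x w).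
Proof.
move=> Pg Px l; apply: polyfun_ext (polyfunM Pg (Px l)) => w.
by rewrite linearZ.
Qed.

Lemma vpolyfun_bilinear (A : 'Hom(W, 'End(W))) x y :
  vpolyfun x -> vpolyfun y -> vpolyfun (fun w => A (x w) (y w)).
Proof.
move=> Px Py l.
apply: (@polyfun_ext
  (fun w => \sum_i coordinates (x w) i * (l \o A e`_i)%VF (y w))).
  move=> w; rewrite {2}(coordinatesE (x w)) linear_sum sum_lfunE linear_sum.
  by apply: eq_bigr => i _; rewrite comp_lfunE linearZ /= scale_lfunE linearZ.
apply: polyfun_sum => i; apply: polyfunM (Py _).
by apply: polyfun_ext (Px (coordinate_form i)) => w; rewrite coordinate_formE.
Qed.

End PolynomialFunctionsOnW.

(** * Cubic forms *)

Section CubicForms.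
Variables (R : realType) (W : vectType R[i]) (f : cubicForm W).
Local Notation C := R[i].
Local Notation n := (\dim {:W}).
Local Notation e := (vbasis {:W}).
Implicit Types (c : C) (l : dual W) (q r u v w x y z p : W).

Lemma cubicDr u v x y : f u v (x + y) = f u v x + f u v y.
Proof. exact: (linearD (f u v : {linear W -> C^o})). Qed.
Lemma cubicZr u v c x : f u v (c *: x) = c * f u v x.
Proof. exact: (linearZ_LR (f u v : {linear W -> C^o})). Qed.
Lemma cubicDm u v x y : f u (x + y) v = f u x v + f u y v.
Proof. by rewrite !(cubicC23 f u _ v) cubicDr. Qed.
Lemma cubicZm u v c x : f u (c *: x) v = c * f u x v.
Proof. by rewrite !(cubicC23 f u _ v) cubicZr. Qed.
Lemma cubicDl u v x y : f (x + y) u v = f x u v + f y u v.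
Proof. by rewrite !(cubicC12 f _ u v) cubicDm. Qed.
Lemma cubicZl u v c x : f (c *: x) u v = c * f x u v.
Proof. by rewrite !(cubicC12 f _ u v) cubicZm. Qed.
Lemma cubicC13 u v w : f u v w = f w v u.
Proof. by rewrite cubicC12 cubicC23 cubicC12. Qed.

Definition cubicE := (cubicDl, cubicDm, cubicDr, cubicZl, cubicZm, cubicZr).

Lemma cubic0r u v : f u v 0 = 0.
Proof. by rewrite -(scale0r (0 : W)) cubicZr mul0r. Qed.
Lemma cubic0m u v : f u 0 v = 0.
Proof. by rewrite cubicC23 cubic0r. Qed.

Lemma polyfun_cubic (x y z : W -> W) : vpolyfun x -> vpolyfun y -> vpolyfun z ->
  polyfun (fun w => f (x w) (y w) (z w)).
Proof.
move=> Px Py Pz.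
apply: (@polyfun_ext _ _ (fun w => \sum_i \sum_j
    coordinates (x w) i * (coordinates (y w) j * contract f e`_i e`_j (z w)))).
  move=> w; rewrite [RHS]cubicC13 -contractE dualE; apply: eq_bigr => i _.
  rewrite -mulr_sumr contractE cubicC23 -contractE dualE; congr (_ * _).
  apply: eq_bigr => j _.
  by rewrite !contractE [in RHS]cubicC12 [in RHS]cubicC23.
by do 2![apply: polyfun_sum => ?]; apply: polyfunM; [|apply: polyfunM (Pz _)];
  [apply: polyfun_ext (Px _) => w | apply: polyfun_ext (Py _) => w];
  exact: coordinate_formE.
Qed.

Lemma cubic_comb x y s t :
  f (s *: x + t *: y) (s *: x + t *: y) (s *: x + t *: y)
  = s ^+ 3 * f x x x + 3 * (s ^+ 2 * t) * f x x y + 3 * (s * t ^+ 2) * f x y y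
  + t ^+ 3 * f y y y.
Proof.
rewrite !cubicE (cubicC12 f y x x) (cubicC12 f y x y) (cubicC23 f x y x).
by rewrite (cubicC13 y y x); ring.
Qed.


Lemma cubic_line q p t : f (q + t *: p) (q + t *: p) (q + t *: p) =
  f q q q + 3 * t * f q q p + 3 * t ^+ 2 * f q p p + t ^+ 3 * f p p p.
Proof. by have := cubic_comb q p 1 t; rewrite !scale1r => ->; ring. Qed.

(** A polynomial that vanishes at the origin is not a unit. *)
Lemma irreducible_not_dvd (g h : W -> C) : irreducible_elt (cubic_poly f) ->
  polyfun g -> polyfun h -> g 0 = 0 -> h 0 = 0 ->
  ~ forall w, f w w w = g w * h w.
Proof.
move=> [_ _ irr] [p Hp] [q Hq] g0 h0 fgh.
have not_unit (r : {mpoly C[n]}) :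
    r.@[coordinates 0] = 0 -> r \isn't a GRing.unit.
  move=> r0; apply/negP => /mulrV /(congr1 (meval (coordinates (0 : W)))).
  by rewrite mevalM r0 mul0r meval1 => /esym/eqP; rewrite oner_eq0.
have /irr[] : cubic_poly f = p * q.
- apply/eqP; rewrite -subr_eq0; apply/eqP/meval_coordinates_eq0 => w.
  by rewrite mevalB mevalM cubic_polyE fgh Hp Hq subrr.
- by apply/negP/not_unit; rewrite -Hp.
- by apply/negP/not_unit; rewrite -Hq.
Qed.

(** Projecting [w] to the hyperplane along a vector [p] with [l p = 1] and
    expanding the cubic exhibits [l] as a factor. *)
Lemma irreducible_hyperplane l : irreducible_elt (cubic_poly f) ->
  l != 0 -> ~ forall w, l w = 0 -> f w w w = 0.
Proof.
move=> irr l_neq0 f0.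
have [p lp1] : exists p, l p = 1.
  have [[i li]|l0] := pselect (exists i : 'I_n, l e`_i != 0).
    by exists ((l e`_i)^-1 *: e`_i); rewrite linearZ; apply: mulVf.
  case/eqP: l_neq0; apply/lfunP => w; rewrite zero_lfunE dualE big1 // => i _.
  by have [->|li] := eqVneq (l e`_i) 0; [rewrite mulr0 | case: l0; exists i].
pose pi w := w + (- l w) *: p.
have Ppi : vpolyfun pi.
  apply: vpolyfunD (@vpolyfun_id R W) (vpolyfunZ _ (vpolyfun_cst _)).
  apply: polyfun_ext (polyfunM (polyfun_cst _ (-1)) (polyfun_dual l)) => w.
  by rewrite mulN1r.
have Pp : vpolyfun (fun=> p) := vpolyfun_cst p.
have Pl := polyfun_dual l.
pose h w := 3 * f (pi w) (pi w) p
  + (3 * (l w * f (pi w) p p) + l w * (l w * f p p p)).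
apply: (@irreducible_not_dvd l h) => //.
- by rewrite /h; repeat (apply: polyfunD || apply: polyfunM
    || apply: polyfun_cst || apply: polyfun_cubic || assumption).
- by rewrite linear0.
- by rewrite /h /pi linear0 oppr0 scale0r addr0 cubic0m !mul0r; ring.
move=> w; have {1 2 3}-> : w = pi w + l w *: p.
  by rewrite /pi -addrA -scalerDl addNr scale0r addr0.
rewrite cubic_line f0 /h; first by ring.
rewrite /pi linearD linearZ /= lp1 scaleNr.
by rewrite /GRing.scale /= mulr1 subrr.
Qed.

Lemma irreducible_form_neq0 : irreducible_elt (cubic_poly f) ->
  exists p, f p p p != 0.
Proof.
move=> [f_neq0 _ _]; apply: contrapT => f0; case/eqP: f_neq0.
apply: meval_coordinates_eq0 => w; rewrite cubic_polyE.
by have [//|fw] := eqVneq (f w w w) 0; case: f0; exists w.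
Qed.

End CubicForms.

(** * The ideal of an irreducible cubic cone *)

Section Primality.
Variables (R : realType) (W : vectType R[i]) (f : cubicForm W).
Local Notation C := R[i].
Local Notation n := (\dim {:W}).
Implicit Types (c : C) (l : dual W) (q u v w x y z p : W).
Hypothesis f_irr : irreducible_elt (cubic_poly f).

Lemma horner_shearW p q t (G : {mpoly C[n]}) :
  (map_poly (meval (coordinates q)) (shear (coordinates p) G)).[t]
  = G.@[coordinates (q + t *: p)].
Proof.
rewrite horner_shear; apply: meval_eq => i.
by rewrite coordinatesD coordinatesZ.
Qed.

(** The rational root theorem for a monic cubic over [C[x]]: [P / Q] is
    integral, hence polynomial. *)
Lemma integral_poly_dvd (P Q a1 a2 a3 : {poly C}) : Q != 0 ->
  P ^+ 3 + P ^+ 2 * Q * a1 + P * Q ^+ 2 * a2 + Q ^+ 3 * a3 = 0 -> Q %| P.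
Proof.
move=> Q_neq0 eqPQ; pose g := gcdp P Q.
have g_neq0 : g != 0 by rewrite gcdp_eq0 negb_and Q_neq0 orbT.
have PE : P = P %/ g * g by rewrite divpK ?dvdp_gcdl.
have QE : Q = Q %/ g * g by rewrite divpK ?dvdp_gcdr.
have cop : coprimep (Q %/ g) (P %/ g).
  by rewrite coprimep_sym coprimep_div_gcd // Q_neq0 orbT.
move: cop PE QE; set P' := P %/ g; set Q' := Q %/ g => cop PE QE.
have eqPQ' : P' ^+ 3 = Q' * - (P' ^+ 2 * a1 + P' * Q' * a2 + Q' ^+ 2 * a3).
  apply: (mulIf (expf_neq0 3 g_neq0)); apply/eqP; rewrite -subr_eq0; apply/eqP.
  by rewrite -eqPQ PE QE; ring.
have Q'1 : Q' %| 1.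
  have : Q' %| P' ^+ 3 by rewrite eqPQ' dvdp_mulr.
  by rewrite -[P' ^+ 3]mulr1 Gauss_dvdpr // coprimep_expr.
by rewrite PE QE dvdp_mul2r // (dvdp_trans Q'1) // dvd1p.
Qed.

(** If [s] had degree at least two, [s ^+ 3] would dominate the other terms. *)
Lemma integral_poly_size (s a1 a2 a3 : {poly C}) :
  (size a1 <= 2)%N -> (size a2 <= 3)%N -> (size a3 <= 4)%N ->
  s ^+ 3 + s ^+ 2 * a1 + s * a2 + a3 = 0 -> (size s <= 2)%N.
Proof.
move=> sz1 sz2 sz3 eqs; rewrite leqNgt; apply/negP => sz.
have s_neq0 : s != 0 by rewrite -size_poly_gt0; lia.
have sz_s2 : size (s ^+ 2) = (size s + size s).-1.
  by rewrite expr2 size_mul.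
have sz_s3 : size (s ^+ 3) = (size s + size (s ^+ 2)).-1.
  by rewrite exprS size_mul // expf_neq0.
have /(congr1 (fun r : {poly C} => size r)) :
    s ^+ 3 = - (s ^+ 2 * a1 + s * a2 + a3).
  by apply/eqP; rewrite -subr_eq0 opprK !addrA eqs.
rewrite size_polyN => szE.
have : (size (s ^+ 2 * a1 + s * a2 + a3)%R <= 3 * (size s).-1)%N.
  apply: leq_trans (size_polyD _ _) _; rewrite geq_max.
  apply/andP; split; last by lia.
  apply: leq_trans (size_polyD _ _) _; rewrite geq_max; apply/andP; split.
    by apply: leq_trans (size_polyMleq _ _) _; lia.
  by apply: leq_trans (size_polyMleq _ _) _; lia.
by rewrite -szE; lia.
Qed.

(** Suppose that [F (q + (P/Q)(q) p) = 0] identically.  Along each line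
    [q0 + x q1] the root [P/Q] is a polynomial [al + bt x] of degree at most
    one, where [al] is its value at [q0] and [bt = bt q1] its differential
    there, which is linear in [q1].  The leading coefficient in [x] gives
    [F (q1 + bt q1 *: p) = 0] for all [q1].  Taking [q1 = p] shows [bt p = -1],
    and then [F] vanishes on the hyperplane [bt = 0]. *)
Lemma no_rational_root p (P Q : {mpoly C[n]}) : f p p p = 1 -> Q != 0 ->
  ~ forall q, let v := Q.@[coordinates q] *: q + P.@[coordinates q] *: p in
    f v v v = 0.
Proof.
move=> fp Q_neq0 FPQ.
have [q0 Qq0] : exists q0, Q.@[coordinates q0] != 0.
  apply: contrapT => Q0; case/eqP: Q_neq0; apply: meval_coordinates_eq0 => w.
  by have [//|Qw] := eqVneq (Q.@[coordinates w]) 0; case: Q0; exists w.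
pose al := P.@[coordinates q0] / Q.@[coordinates q0].
pose bt : dual W := \sum_i ((P^`M(i).@[coordinates q0]
  - al * Q^`M(i).@[coordinates q0]) / Q.@[coordinates q0]) *: coordinate_form i.
have btE q : bt q * Q.@[coordinates q0] =
    \sum_i coordinates q i * P^`M(i).@[coordinates q0]
    - al * \sum_i coordinates q i * Q^`M(i).@[coordinates q0].
  rewrite sum_lfunE mulr_suml mulr_sumr -sumrB; apply: eq_bigr => i _.
  rewrite scale_lfunE /= coordinate_formE.
  rewrite /GRing.scale /= mulrAC divfK //.
  move: (P^`M(i).@[_]) (Q^`M(i).@[_]) => dP dQ.
  by ring.
have alE : al * Q.@[coordinates q0] = P.@[coordinates q0] by rewrite divfK.
clearbody al bt.
have Fbt q1 :
  f (q1 + bt q1 *: p) (q1 + bt q1 *: p) (q1 + bt q1 *: p) = 0.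
  pose line G := map_poly (meval (coordinates q0)) (shear (coordinates q1) G).
  have line0 G : (line G)`_0 = G.@[coordinates q0].
    by rewrite coef_map coef0_shear.
  have line1 G : (line G)`_1 =
      \sum_i coordinates q1 i * G^`M(i).@[coordinates q0].
    rewrite coef_map coef1_shear raddf_sum; apply: eq_bigr => i _.
    exact: mevalZ.
  have lineE G t : (line G).[t] = G.@[coordinates (q0 + t *: q1)].
    exact: horner_shearW.
  clearbody line; have lineQ_neq0 : line Q != 0.
    by apply: contra_neq Qq0 => lQ; rewrite -line0 lQ coef0.
  pose a1 : {poly C} := 3 *: Poly [:: f q0 p p; f q1 p p].
  pose a2 : {poly C} := 3 *: Poly [:: f q0 q0 p; 2 * f q0 q1 p; f q1 q1 p].
  pose a3 : {poly C} :=
    Poly [:: f q0 q0 q0; 3 * f q0 q0 q1; 3 * f q0 q1 q1; f q1 q1 q1].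
  have eqPQ : line P ^+ 3 + line P ^+ 2 * line Q * a1
      + line P * line Q ^+ 2 * a2 + line Q ^+ 3 * a3 = 0.
    apply: poly_horner_inj => t; have := FPQ (q0 + t *: q1).
    rewrite /= cubic_comb fp cubic_line => E; rewrite horner0 -[RHS]E.
    rewrite !(hornerD, hornerM, hornerZ, horner_exp, horner_Poly) /=.
    rewrite !lineE.
    by rewrite !cubicE (cubicC12 f q1 q0); ring.
  have /dvdpP [s sE] := integral_poly_dvd lineQ_neq0 eqPQ.
  have eqs : s ^+ 3 + s ^+ 2 * a1 + s * a2 + a3 = 0.
    apply: (mulIf (expf_neq0 3 lineQ_neq0)); rewrite mul0r -[RHS]eqPQ sE; ring.
  have sz_s : (size s <= 2)%N.
    by apply: integral_poly_size eqs;
      rewrite ?(leq_trans (size_scale_leq _ _)) // size_Poly.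
  have s0 : s`_0 = al.
    by apply: (mulIf Qq0); rewrite alE -!line0 sE coef0M.
  have s1 : s`_1 = bt q1.
    apply: (mulIf Qq0); rewrite btE -!line1 -line0 sE coefM.
    by rewrite big_ord_recl big_ord1 /= s0; ring.
  have sP : s = Poly [:: al; bt q1].
    apply/polyP => -[|[|k]]; rewrite coef_Poly //= nth_default ?nth_nil //.
    exact: leq_trans sz_s _.
  pose v0 := q0 + al *: p; pose v1 := q1 + bt q1 *: p.
  have : Poly [:: f v0 v0 v0; 3 * f v0 v0 v1; 3 * f v0 v1 v1; f v1 v1 v1]
      = 0 :> {poly C}.
    apply: poly_horner_inj => t; move/(congr1 (horner^~ t)): eqs.
    rewrite sP horner0.
    rewrite !(hornerD, hornerM, hornerZ, horner_exp, horner_Poly) /= => E.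
    rewrite -[RHS]E.
    have := cubic_line f v0 v1 t.
    have -> : v0 + t *: v1 = (q0 + t *: q1) + (al + bt q1 * t) *: p.
      by rewrite /v0 /v1 scalerDr scalerA scalerDl addrACA (mulrC t).
    rewrite cubic_line cubic_line fp => E'.
    transitivity (f v0 v0 v0 + 3 * t * f v0 v0 v1 + 3 * t ^+ 2 * f v0 v1 v1
      + t ^+ 3 * f v1 v1 v1); first by ring.
    rewrite -E'; rewrite !cubicE (cubicC12 f q1 q0); ring.
  by move=> /(congr1 (fun r : {poly C} => r`_3)); rewrite coef_Poly coef0.
have btp : bt p = -1.
  have := Fbt p; have -> : p + bt p *: p = (1 + bt p) *: p.
    by rewrite scalerDl scale1r.
  rewrite !cubicE fp mulr1.
  move/eqP; rewrite !mulf_eq0 !orbb => /eqP E.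
  by apply/eqP; rewrite -subr_eq0 opprK addrC E.
apply: (irreducible_hyperplane f_irr (l := bt)).
  apply/eqP => bt0; have /eqP := btp; rewrite bt0 zero_lfunE.
  by rewrite eq_sym oppr_eq0 oner_eq0.
by move=> w btw; have := Fbt w; rewrite btw scale0r addr0.
Qed.

Lemma shear_eval_inj (P Q : {poly {mpoly C[n]}}) :
  (forall q t, (map_poly (meval (coordinates q)) P).[t]
             = (map_poly (meval (coordinates q)) Q).[t]) -> P = Q.
Proof.
move=> PQ; apply/polyP => i; apply/eqP; rewrite -subr_eq0; apply/eqP.
apply: meval_coordinates_eq0 => q; have /(congr1 (fun r : {poly C} => r`_i)) :=
  poly_horner_inj (PQ q).
by rewrite !coef_map mevalB /= => ->; rewrite subrr.
Qed.

Lemma shear_cubic p : f p p p = 1 ->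
  exists c0 c1 c2 : {mpoly C[n]},
    shear (coordinates p) (cubic_poly f) = Poly [:: c0; c1; c2; 1].
Proof.
move=> fp; have [c1 c1E] : polyfun (fun w => 3 * f w w p).
  apply: polyfunM (polyfun_cst _ _) _.
  by apply: polyfun_cubic; try exact: vpolyfun_id; exact: vpolyfun_cst.
have [c2 c2E] : polyfun (fun w => 3 * f w p p).
  apply: polyfunM (polyfun_cst _ _) _.
  by apply: polyfun_cubic; try exact: vpolyfun_id; exact: vpolyfun_cst.
exists (cubic_poly f), c1, c2; apply: shear_eval_inj => q t.
rewrite horner_shearW cubic_polyE cubic_line fp.
have -> : map_poly (meval (coordinates q)) (Poly [:: cubic_poly f; c1; c2; 1])
   = Poly [:: f q q q; 3 * f q q p; 3 * f q p p; 1].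
  apply/polyP => -[|[|[|[|i]]]]; 
    rewrite coef_map !coef_Poly //= ?meval1 -?c1E -?c2E //.
    exact: cubic_polyE.
  by rewrite !nth_nil meval0.
by rewrite horner_Poly /=; ring.
Qed.

(** The root of a factor of degree one in [t] is a rational function of [q]. *)
Lemma shear_no_linear_factor p (c : {mpoly C[n]}) (d e : {poly {mpoly C[n]}}) :
  f p p p = 1 -> c != 0 ->
  c *: shear (coordinates p) (cubic_poly f) = e * d -> size d != 2%N.
Proof.
move=> fp c_neq0 cFE; apply/negP => /eqP sz_d.
have lead_d : lead_coef d = d`_1 by rewrite lead_coefE sz_d.
have Q_neq0 : d`_1 != 0 by rewrite -lead_d lead_coef_eq0 -size_poly_gt0 sz_d.
pose F (q : W) :=
  let v := (d`_1).@[coordinates q] *: q + (- d`_0).@[coordinates q] *: p in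
  f v v v.
apply: (@no_rational_root p (- d`_0) _ fp Q_neq0).
have PF : polyfun F.
  have PQ (P : {mpoly C[n]}) : polyfun (fun q : W => P.@[coordinates q]).
    by exists P.
  have Pv : vpolyfun (fun q : W =>
      (d`_1).@[coordinates q] *: q + (- d`_0).@[coordinates q] *: p).
    apply: vpolyfunD; apply: vpolyfunZ => //; first exact: vpolyfun_id.
    exact: vpolyfun_cst.
  exact: polyfun_cubic.
have [] := @polyfun_mul_eq0 _ _ (fun q => (c * d`_1).@[coordinates q]) F _ PF.
- by exists (c * d`_1).
- move=> q; rewrite /F mevalM; have [->|Qq] := eqVneq (d`_1).@[coordinates q] 0.
    by rewrite mulr0 mul0r.
  set Q := (d`_1).@[_] in Qq *; set P := (- d`_0).@[_].
  move/(congr1 (fun r => (map_poly (meval (coordinates q)) r).[P / Q])): cFE.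
  rewrite map_polyZ hornerZ horner_shearW cubic_polyE rmorphM hornerM.
  have -> : (map_poly (meval (coordinates q)) d).[P / Q] = 0.
    rewrite (@horner_coef_wide _ 2) ?(leq_trans (size_poly _ _)) ?sz_d //.
    rewrite big_ord_recl big_ord1 /= !coef_map /= -/Q expr0 mulr1.
    by rewrite expr1 mulrC divfK // /P mevalN subrr.
  rewrite mulr0 => E; have -> : Q *: q + P *: p = Q *: (q + (P / Q) *: p).
    by rewrite scalerDr scalerA mulrC divfK.
  rewrite !cubicE; rewrite !cubicE in E.
  transitivity (Q ^+ 4 * 0); last by rewrite mulr0.
  by rewrite -E /=; ring.
- move=> cd0; have /eqP : c * d`_1 = 0 by apply: meval_coordinates_eq0.
  by rewrite mulf_eq0 (negPf c_neq0) (negPf Q_neq0).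
- by move=> F0 q; exact: F0.
Qed.

(** Over the polynomial ring in [q], divide the restriction of [G] to the lines
    of direction [p] by the monic cubic.  If the remainder is nonzero, it has no
    factor in common with the cubic, since one of the two complementary factors
    of the cubic would have degree one.  So their resultant [r] is nonzero, and
    where [r] does not vanish they have no common root. *)
Lemma dvd_or_generically_nonzero p (G : {mpoly C[n]}) : f p p p = 1 ->
  (exists Q, G = cubic_poly f * Q) \/
  exists2 r : {mpoly C[n]}, r != 0 & forall q t,
    let v := q + t *: p in
    r.@[coordinates q] != 0 -> f v v v = 0 -> G.@[coordinates v] != 0.
Proof.
move=> fp; have [c0 [c1 [c2 FE]]] := shear_cubic fp.
set F := shear _ _ in FE; pose Gs := shear (coordinates p) G.
have sF : F = [:: c0; c1; c2; 1] :> seq _.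
  by rewrite FE (PolyK (c := 0)) //= oner_neq0.
have F_monic : F \is monic by rewrite monicE lead_coefE sF.
have sz_F : size F = 4%N by rewrite sF.
have GE := Pdiv.IdomainMonic.divp_eq F_monic Gs.
set Qs := Gs %/ F in GE; set Rm := Gs %% F in GE.
have sz_Rm : (size Rm < 4)%N by rewrite -sz_F ltn_modp monic_neq0.
have evalR q t : let v := q + t *: p in f v v v = 0 ->
    (map_poly (meval (coordinates q)) Rm).[t] = G.@[coordinates v].
  move=> v fv; rewrite -horner_shearW -/Gs GE rmorphD rmorphM hornerD hornerM.
  by rewrite horner_shearW cubic_polyE fv mulr0 add0r.
have [Rm0|Rm_neq0] := eqVneq Rm 0.
  left; exists Qs`_0; move/(congr1 (fun r : {poly {mpoly C[n]}} => r`_0)): GE.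
  by rewrite Rm0 addr0 coef0M !coef0_shear mulrC.
right; have [sz_Rm1|sz_Rm1] := leqP (size Rm) 1.
  move: Rm_neq0 evalR; rewrite (size1_polyC sz_Rm1) polyC_eq0 => r_neq0 evalR.
  exists Rm`_0 => // q t v rq fv.
  by rewrite -(evalR q t fv) map_polyC hornerC.
have sz_F1 : (1 < size F)%N by rewrite sz_F.
have [r0|r_neq0] := eqVneq (resultant F Rm) 0; last first.
  exists (resultant F Rm) => // q t v rq fv.
  have [[u v'] _ rE] := resultant_in_ideal sz_F1 sz_Rm1.
  move/(congr1 (fun r => (map_poly (meval (coordinates q)) r).[t])): rE.
  rewrite map_polyC hornerC rmorphD !rmorphM hornerD !hornerM /= horner_shearW.
  rewrite cubic_polyE fv mulr0 add0r (evalR q t fv) => rE.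
  by apply: contra_neq rq => Gv; rewrite rE Gv mulr0.
exfalso; move/eqP: r0; rewrite resultant_eq0.
set d := Pdiv.Idomain.gcdp F Rm => sz_d.
have sz_d3 : (size d < 4)%N.
  apply: leq_ltn_trans sz_Rm; apply: Pdiv.Idomain.dvdp_leq => //.
  exact: Pdiv.Idomain.dvdp_gcdr.
have /Pdiv.Idomain.dvdpP [[c e] /= c_neq0 cFE] := Pdiv.Idomain.dvdp_gcdl F Rm.
have := congr1 (fun r : {poly _} => size r) cFE.
have e_neq0 : e != 0.
  apply: contra_eq_neq cFE => ->; rewrite mul0r -size_poly_eq0 size_scale //.
  by rewrite sz_F.
have d_neq0 : d != 0 by rewrite -size_poly_gt0; apply: ltn_trans sz_d.
rewrite size_scale // sz_F size_mul // => szE.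
have /eqP := shear_no_linear_factor fp c_neq0 cFE.
have : size e != 2%N.
  by apply: shear_no_linear_factor fp c_neq0 _; rewrite mulrC; exact: cFE.
move=> /eqP; rewrite -/d in sz_d *; move: sz_d sz_d3 szE; clear.
by move: (size d) (size e); lia.
Qed.

End Primality.

(** * Functions on the cone and its infinitesimal automorphisms *)

Section Cone.
Variables (R : realType) (W : vectType R[i]) (f : cubicForm W).
Local Notation C := R[i].
Local Notation n := (\dim {:W}).
Implicit Types (c : C) (l : dual W) (q u v w x y z p : W) (g : W -> C).
Hypothesis f_irr : irreducible_elt (cubic_poly f).

Lemma exists_cubic_eq1 : exists p, f p p p = 1.
Proof.
have [p fp] := irreducible_form_neq0 f_irr.
pose r := 3.-root (f p p p); have rK : r ^+ 3 = f p p p by rewrite rootCK.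
have r_neq0 : r != 0 by apply: contra_neq fp => r0; rewrite -rK r0 expr0n.
by exists (r^-1 *: p); rewrite !cubicE -rK; field.
Qed.

Lemma exists_line_root p q : f p p p = 1 -> exists t,
  f (q + t *: p) (q + t *: p) (q + t *: p) = 0.
Proof.
move=> fp; pose P : {poly C} := Poly [:: f q q q; 3 * f q q p; 3 * f q p p; 1].
have sP : P = [:: f q q q; 3 * f q q p; 3 * f q p p; 1] :> seq _.
  by rewrite (PolyK (c := 0)) //= oner_neq0.
have /closed_rootP [t /rootP Pt] : size P != 1%N by rewrite sP.
by exists t; rewrite cubic_line fp -[RHS]Pt horner_Poly /=; ring.
Qed.

(** If neither function is divisible by the cubic, some line of direction [p]
    meets the cone and avoids the zeros of both functions on it. *)
Lemma cone_irreducible g1 g2 : polyfun g1 -> polyfun g2 ->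
  (forall w, f w w w = 0 -> g1 w * g2 w = 0) ->
  (forall w, f w w w = 0 -> g1 w = 0) \/ (forall w, f w w w = 0 -> g2 w = 0).
Proof.
move=> [G1 g1E] [G2 g2E] g120; have [p fp] := exists_cubic_eq1.
have [[Q G1E]|[r1 r1_neq0 r1P]] := dvd_or_generically_nonzero f_irr G1 fp.
  by left => w fw; rewrite g1E G1E mevalM cubic_polyE fw mul0r.
have [[Q G2E]|[r2 r2_neq0 r2P]] := dvd_or_generically_nonzero f_irr G2 fp.
  by right => w fw; rewrite g2E G2E mevalM cubic_polyE fw mul0r.
exfalso; have : r1 * r2 != 0 by rewrite mulf_neq0.
apply/negP; rewrite negbK; apply/eqP/meval_coordinates_eq0 => q.
apply/eqP; rewrite mevalM mulf_eq0 -[_ || _]negbK negb_or.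
apply/negP => /andP [r1q r2q].
have [t ft] := exists_line_root q fp.
have /eqP := g120 _ ft; rewrite g1E g2E mulf_eq0.
by rewrite (negPf (r1P _ _ r1q ft)) (negPf (r2P _ _ r2q ft)).
Qed.

Lemma cone_vanishing_dvd g : polyfun g -> (forall w, f w w w = 0 -> g w = 0) ->
  exists h : {mpoly C[n]}, forall w, g w = f w w w * h.@[coordinates w].
Proof.
move=> [G gE] g0; have [p fp] := exists_cubic_eq1.
have [[Q GE]|[r /eqP r_neq0 rP]] := dvd_or_generically_nonzero f_irr G fp.
  by exists Q => w; rewrite gE GE mevalM cubic_polyE.
exfalso; apply/r_neq0/meval_coordinates_eq0 => q; apply/eqP/negP => /negP rq.
have [t ft] := exists_line_root q fp.
by have /eqP[] := rP _ _ rq ft; rewrite -gE g0.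
Qed.

(** Restricting the factorisation [g = F h] to a line through the origin, in a
    form from which homogeneous components can be compared. *)
Lemma cone_vanishing_line g : polyfun g -> (forall w, f w w w = 0 -> g w = 0) ->
  exists c, forall w, exists2 r : {poly C}, r`_0 = c &
    forall t, g (t *: w) = t ^+ 3 * f w w w * r.[t].
Proof.
move=> Pg g0; have [h gE] := cone_vanishing_dvd Pg g0.
exists h.@[coordinates (0 : W)] => w.
exists (map_poly (meval (coordinates (0 : W))) (shear (coordinates w) h)).
  by rewrite coef_map coef0_shear.
by move=> t; rewrite horner_shearW add0r gE !cubicE; ring.
Qed.

Lemma cone_vanishing_quadratic g : polyfun g ->
  (forall t w, g (t *: w) = t ^+ 2 * g w) ->
  (forall w, f w w w = 0 -> g w = 0) -> forall w, g w = 0.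
Proof.
move=> Pg gZ g0 w; have [c /(_ w) [r _ rE]] := cone_vanishing_line Pg g0.
have /(congr1 (fun s : {poly C} => s`_2)) : g w *: 'X^2 = (f w w w *: r) * 'X^3.
  apply: poly_horner_inj => t; rewrite !hornerE /=.
  by transitivity (g (t *: w)); [rewrite gZ; ring | rewrite rE; ring].
by rewrite coefZ coefXn mulr1 coefMXn.
Qed.

Lemma cone_vanishing_cubic g : polyfun g ->
  (forall t w, g (t *: w) = t ^+ 3 * g w) ->
  (forall w, f w w w = 0 -> g w = 0) -> exists c, forall w, g w = c * f w w w.
Proof.
move=> Pg gZ g0; have [c Hc] := cone_vanishing_line Pg g0.
exists c => w; have [r r0 rE] := Hc w.
have /(congr1 (fun s : {poly C} => s`_3)) : g w *: 'X^3 = (f w w w *: r) * 'X^3.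
  apply: poly_horner_inj => t; rewrite !hornerE /=.
  by transitivity (g (t *: w)); [rewrite gZ; ring | rewrite rE; ring].
by rewrite coefZ coefXn mulr1 coefMXn /= coefZ r0 mulrC.
Qed.

Lemma cubic_gradient w v :
  \sum_i ((cubic_poly f)^`M(i)).@[coordinates w] * coordinates v i
  = 3 * f w w v.
Proof.
pose r : {poly C} := Poly [:: f w w w; 3 * f w w v; 3 * f w v v; f v v v].
have /(congr1 (fun s : {poly C} => s`_1)) : map_poly (meval (coordinates w))
    (shear (coordinates v) (cubic_poly f)) = r.
  apply: poly_horner_inj => t; rewrite horner_shearW cubic_polyE cubic_line.
  by rewrite horner_Poly /=; ring.
rewrite coef_map coef1_shear coef_Poly /= raddf_sum => <-.
by apply: eq_bigr => i _; rewrite /= mevalZ mulrC.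
Qed.

Lemma cone_singularP w : cone_singular f w <-> forall v, f w w v = 0.
Proof.
split=> [[_ dF] v|fw].
  apply: (mulfI (_ : 3 != 0 :> C)); first by rewrite pnatr_eq0.
  by rewrite mulr0 -cubic_gradient big1 // => i _; rewrite dF mul0r.
split=> [|i]; first exact: fw.
have coordE j : coordinates (vbasis {:W})`_i j = (i == j)%:R.
  by apply: coord_free; apply: basis_free (vbasisP _).
have := cubic_gradient w (vbasis {:W})`_i.
rewrite fw mulr0 (bigD1 i) //= big1 => [|j jNi]; rewrite coordE.
  by rewrite eqxx mulr1 addr0.
by rewrite eq_sym (negPf jNi) mulr0.
Qed.

Lemma quadratic_polarization (b : W -> W -> C) :
  (forall u v w, b (u + v) w = b u w + b v w) ->
  (forall u v, b u v = b v u) -> (forall w, b w w = 0) -> forall u v, b u v = 0.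
Proof.
move=> bD bC b0 u v; have := b0 (u + v).
rewrite bD !(bC _ (u + v)) !bD !b0 (bC v u) addr0 add0r -mulr2n => /eqP.
by rewrite mulrn_eq0 => /eqP.
Qed.

Lemma cubic_polarization (T : W -> W -> W -> C) :
  (forall u v w x, T (u + v) w x = T u w x + T v w x) ->
  (forall u v w, T u v w = T v u w) -> (forall u v w, T u v w = T u w v) ->
  (forall w, T w w w = 0) -> forall u v w, T u v w = 0.
Proof.
move=> TD T12 T23 T0.
have TDm u v w x : T w (u + v) x = T w u x + T w v x by rewrite !(T12 w) TD.
have TDr u v w x : T w x (u + v) = T w x u + T w x v by rewrite !(T23 w x) TDm.
have E w x : T w w x + T w x x = 0.
  apply: (mulfI (_ : 3 != 0 :> C)); first by rewrite pnatr_eq0.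
  rewrite mulr0 -[RHS](T0 (w + x)) !(TD, TDm, TDr) !T0.
  by rewrite (T23 x x w) !(T12 x w) (T23 w x w); ring.
have T1 u v : T u u v = 0.
  have a := E u v; have := E u (v + v); rewrite !(TDm, TDr) => b.
  apply: (mulfI (_ : 2 != 0 :> C)); first by rewrite pnatr_eq0.
  transitivity (4 * (T u u v + T u v v) - (T u u v + T u u v
    + (T u v v + T u v v + (T u v v + T u v v)))); first by ring.
  by rewrite a b; ring.
move=> u v w; apply: (@quadratic_polarization (fun u v => T u v w)) => //.
Qed.

(** The cubic form [w |-> f w w (phi w)] vanishes at the smooth points of the
    cone by tangency, and at the singular points because [f_ww = 0] there.  So
    it is a multiple of the cubic, and polarization gives the character. *)
Lemma aut_cone_character (phi : 'End(W)) : aut_cone f phi ->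
  exists c, is_character f phi c.
Proof.
move=> Hphi.
have phi0 w : f w w w = 0 -> f w w (phi w) = 0.
  move=> fw; have [sw|nsw] := pselect (cone_singular f w).
    by move/cone_singularP: sw; apply.
  apply: (mulfI (_ : 3 != 0 :> C)); first by rewrite pnatr_eq0.
  by rewrite mulr0 -cubic_gradient; apply: Hphi.
have [||c cE] := cone_vanishing_cubic _ _ phi0.
- apply: polyfun_cubic; [exact: vpolyfun_id | exact: vpolyfun_id |] => l.
  by apply: polyfun_ext (polyfun_dual (l \o phi)%VF) => w; rewrite comp_lfunE.
- by move=> t w; rewrite linearZ !cubicE; ring.
exists (3 * c) => u v w; apply/eqP; rewrite -subr_eq0; apply/eqP.
pose T u v w := f (phi u) v w + f u (phi v) w + f u v (phi w) - 3 * c * f u v w.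
rewrite -/(T u v w); apply: cubic_polarization => {u v w}.
- by move=> u v w x; rewrite /T linearD !cubicE; ring.
- move=> u v w; rewrite /T (cubicC12 f (phi u)) (cubicC12 f u (phi v)).
  by rewrite !(cubicC12 f u v); ring.
- move=> u v w; rewrite /T (cubicC23 f (phi u)) (cubicC23 f u v).
  by rewrite (cubicC23 f u (phi v)) (cubicC23 f u v w); ring.
- by move=> w; rewrite /T (cubicC13 f (phi w)) (cubicC23 f w (phi w)) cE; ring.
Qed.

End Cone.

(** * The Hessian matrix *)

Section HessianMatrix.
Variables (R : realType) (W : vectType R[i]) (f : cubicForm W).
Local Notation C := R[i].
Local Notation n := (\dim {:W}).
Local Notation e := (vbasis {:W}).
Implicit Types (c : C) (l : dual W) (q u v w x y z p : W) (g : W -> C).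

Definition hessian v : 'M[C]_n := \matrix_(i, j) f v e`_i e`_j.

Lemma mul_hessian v (x : 'rV[C]_n) j :
  (x *m hessian v) 0 j = f v (\sum_i x 0 i *: e`_i) e`_j.
Proof.
rewrite cubicC23 -contractE linear_sum mxE; apply: eq_bigr => i _.
by rewrite linearZ mxE /= contractE cubicC23.
Qed.

Lemma polyfun_det_hessian : polyfun (fun v => \det (hessian v)).
Proof.
apply: polyfun_sum => s; apply: polyfunM (polyfun_cst _ _) _.
apply: polyfun_prod => i.
apply: (@polyfun_ext _ _ (fun v => f v e`_i e`_(perm.fun_of_perm s i))) => [v|].
  by rewrite mxE.
by apply: polyfun_cubic; try exact: vpolyfun_id; exact: vpolyfun_cst.
Qed.

Lemma hessian_inj v u :
  \det (hessian v) != 0 -> (forall x, f v u x = 0) -> u = 0.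
Proof.
move=> dv fvu; pose x : 'rV[C]_n := \row_i coordinates u i.
have uE : u = \sum_i x 0 i *: e`_i.
  by rewrite {1}(coordinatesE u); apply: eq_bigr => i _; rewrite mxE.
have x0 : x *m hessian v = 0.
  by apply/rowP => j; rewrite mul_hessian -uE fvu mxE.
rewrite uE big1 // => i _.
have -> : x = 0.
  have uv : hessian v \in unitmx by rewrite unitmxE unitfE.
  by rewrite -[x](mulmxK uv) x0 mul0mx.
by rewrite mxE scale0r.
Qed.

Lemma hessian_surj v l : \det (hessian v) != 0 -> exists u, contract f v u = l.
Proof.
move=> dv; pose x := \row_j l e`_j *m invmx (hessian v).
exists (\sum_i x 0 i *: e`_i); apply/lfunP => w; rewrite !(dualE _ w).
apply: eq_bigr => j _; rewrite contractE -mul_hessian mulmxKV ?mxE //.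
Qed.

Hypothesis f_hess : nonzero_hessian f.

Lemma exists_hessian : exists v, \det (hessian v) != 0.
Proof.
have [v vP] := f_hess; exists v; apply/det0P => -[x x_neq0 x0].
pose u := \sum_i x 0 i *: e`_i.
have u_neq0 : u != 0.
  apply: contra_neq x_neq0 => u0; apply/rowP => i.
  rewrite mxE -(coordinatesK (fun i => x 0 i)) -/u u0.
  exact: linear0.
have /eqP[] := vP _ u_neq0; apply/lfunP => w.
rewrite zero_lfunE dualE big1 // => j _.
by rewrite contractE -mul_hessian x0 mxE mulr0.
Qed.

(** The points with invertible Hessian matrix are Zariski dense. *)
Lemma hessian_dense g : polyfun g ->
  (forall v, \det (hessian v) != 0 -> g v = 0) -> forall v, g v = 0.
Proof.
move=> Pg g0; have [v|d0|//] := polyfun_mul_eq0 polyfun_det_hessian Pg.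
  by have [->|/g0 ->] := eqVneq (\det (hessian v)) 0; rewrite ?mul0r ?mulr0.
by have [v] := exists_hessian; rewrite d0 eqxx.
Qed.

Lemma contractC u v : contract f u v = contract f v u.
Proof. by apply/lfunP => x; rewrite !contractE cubicC12. Qed.

End HessianMatrix.

Section TwoForms.
Variables (R : realType) (W : vectType R[i]) (f : cubicForm W).
Local Notation C := R[i].
Implicit Types (c : C) (l : dual W) (q u v w x y z p : W) (g : W -> C).
Hypothesis f_irr : irreducible_elt (cubic_poly f).

(** This is the statement that the dimension is at least three.  Otherwise the
    pair [(l1, l2)] is injective; for a nonzero [w0] in the cone, the
    combination of [l1] and [l2] that vanishes at [w0] has kernel the line of
    [w0], and the cubic vanishes on that line. *)
Lemma exists_common_zero l1 l2 : exists2 u, u != 0 & l1 u = 0 /\ l2 u = 0.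
Proof.
apply: contrapT => l12.
have inj u : l1 u = 0 -> l2 u = 0 -> u = 0.
  by move=> u1 u2; apply/eqP/negP => /negP u_neq0; apply: l12; exists u.
have [p fp] := exists_cubic_eq1 f_irr.
have p_neq0 : p != 0.
  by apply: contra_eq_neq fp => ->; rewrite cubic0r eq_sym oner_neq0.
have line_absurd x : f x x x = 0 -> forall l, l != 0 ->
    ~ forall u, l u = 0 -> exists c, u = c *: x.
  move=> fx l l_neq0 kl.
  apply: (irreducible_hyperplane f_irr l_neq0) => u /kl [c ->].
  by rewrite !cubicE fx !mulr0.
have [w0 w0_neq0 fw0] : exists2 w, w != 0 & f w w w = 0.
  have [[q qp]|allp] := pselect (exists q, forall c, q != c *: p).
    have [t ft] := exists_line_root q fp; exists (q + t *: p) => //.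
    by rewrite addr_eq0 -scaleNr qp.
  have [l lp] := separating_dual p_neq0.
  case: (line_absurd 0 _ l) => [||u lu].
  - exact: cubic0r.
  - by apply: contraNneq lp => ->; rewrite zero_lfunE.
  exists 0; rewrite scaler0; apply: contrapT => u_neq0; apply: allp.
  exists u => c; apply: contra_not_neq u_neq0 => uE.
  have /eqP := lu; rewrite uE linearZ mulf_eq0 (negPf lp) orbF => /eqP ->.
  by rewrite scale0r.
have prop (k1 k2 : dual W) u : (forall u, k1 u = 0 -> k2 u = 0 -> u = 0) ->
    k1 w0 != 0 -> k2 w0 * k1 u = k1 w0 * k2 u -> u = (k1 u / k1 w0) *: w0.
  move=> kinj k1w0 E; apply/eqP; rewrite -subr_eq0; apply/eqP/kinj.
    by rewrite linearB linearZ /= /GRing.scale /= divfK // subrr.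
  rewrite linearB linearZ /= /GRing.scale /=; apply: (mulfI k1w0).
  by rewrite mulrBr -E mulr0; field.
pose l : dual W := l2 w0 *: l1 - l1 w0 *: l2.
have lE u : l u = 0 -> exists c, u = c *: w0.
  rewrite add_lfunE opp_lfunE !scale_lfunE => /eqP; rewrite subr_eq0 => /eqP E.
  have [l1w0|l1w0] := eqVneq (l1 w0) 0; last first.
    by exists (l1 u / l1 w0); apply: (prop l1 l2).
  have l2w0 : l2 w0 != 0 by apply: contra_neq w0_neq0; apply: inj.
  by exists (l2 u / l2 w0); apply: (prop l2 l1) => // v v2 v1; apply: inj.
apply: (line_absurd _ fw0 _ _ lE); apply/eqP => l0.
have [c pE] : exists c, p = c *: w0 by apply: lE; rewrite l0 zero_lfunE.
by have /eqP := fp; rewrite pE !cubicE fw0 !mulr0 eq_sym oner_eq0.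
Qed.
End TwoForms.

(** * Prolongations of the prescribed form *)

(** Certificates for linear consequences of equations, to be checked by [ring]
    or [field]. *)
Lemma eq_lincomb1 (K : comNzRingType) (k a b x y : K) :
  a = b -> x - y = k * (a - b) -> x = y.
Proof. by move=> ->; rewrite subrr mulr0 => /subr0_eq. Qed.

Lemma eq_lincomb2 (K : comNzRingType) (k1 k2 a1 b1 a2 b2 x y : K) :
  a1 = b1 -> a2 = b2 -> x - y = k1 * (a1 - b1) + k2 * (a2 - b2) -> x = y.
Proof. by move=> -> ->; rewrite !subrr !mulr0 addr0 => /subr0_eq. Qed.

Section Prolongation.
Variables (R : realType) (W : vectType R[i]) (f : cubicForm W).
Local Notation C := R[i].
Implicit Types (c : C) (l : dual W) (q u v w x y z p : W) (g : W -> C).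
Hypotheses (f_irr : irreducible_elt (cubic_poly f))
  (f_hess : nonzero_hessian f).
Variables (A : 'Hom(W, 'End(W))) (h : 'Hom(dual W, W)) (chi : dual W).
Hypothesis chiP : forall w, is_character f (A w) (chi w).
Local Notation hh u v := (h (contract f u v)).

Definition prolongation_form a :=
  forall u v, A u v = (a * chi u) *: v + (a * chi v) *: u + hh u v.

Lemma prolongation_identity a w u v x : prolongation_form a ->
  3 * a * chi w * f u v x
  + a * (chi u * f w v x + chi v * f w u x + chi x * f w u v)
  + (f v x (hh w u) + f u x (hh w v) + f u v (hh w x)) = chi w * f u v x.
Proof.
move=> AE; rewrite -(chiP w u v x) !AE !cubicE.
rewrite (cubicC13 f (hh w u)) (cubicC12 f x v) (cubicC23 f u (hh w v)).
rewrite (cubicC12 f u w x) (cubicC23 f u v w) (cubicC12 f u w v); ring.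
Qed.

(** The difference of the identity and of its transform under the exchange of
    [w] and [u]. *)
Lemma prolongation_skew a w u v : prolongation_form a ->
  (1 - 2 * a) * (chi w * f u v v - chi u * f w v v)
  = 2 * (f u v (hh w v) - f w v (hh u v)).
Proof.
move=> AE; have := prolongation_identity w u v v AE.
have := prolongation_identity u w v v AE.
rewrite (contractC f u w) (cubicC12 f u w) => E1 E2.
by apply: (eq_lincomb2 (k1 := -1) (k2 := 1) E2 E1); ring.
Qed.

(** Suppose [a <> 1/2].  Let [v0] have invertible Hessian matrix and let [u] be
    a nonzero vector killed by [chi] and by [f_{v0 v0}].  The skew relation at
    [v0] puts [f_{u v0}] in the radical of the skew part of [h].  Writing the
    same functional as [f_{x v}] at another general point [v] gives
    [chi w * f u v0 v = chi x * f w v v] for all [w]; with [w = u] one finds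
    [f u v0 v * f u v v = 0] for all [v], although [f_u] is nonzero. *)
Lemma prolongation_coef a : prolongation_form a -> chi != 0 -> a = 2^-1.
Proof.
move=> AE chi_neq0; apply/eqP/negP => /negP a_neq.
have b_neq0 : 1 - 2 * a != 0.
  apply: contra_neq a_neq => E.
  apply: (mulfI (_ : 2 != 0 :> C)); first by rewrite pnatr_eq0.
  rewrite mulfV ?pnatr_eq0 //; apply/eqP.
  by rewrite -subr_eq0 -oppr_eq0 opprB E.
have [v0 dv0] := exists_hessian f_hess.
have [u u_neq0 [chiu fuv0]] := exists_common_zero f_irr chi (contract f v0 v0).
rewrite contractE cubicC13 in fuv0.
have two_neq0 : 2 != 0 :> C by rewrite pnatr_eq0.
have hu (l : dual W) : f u v0 (h l) = l (hh u v0).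
  have [w <-] := hessian_surj l dv0; rewrite contractE.
  apply/eqP; rewrite -subr_eq0; apply/eqP/(mulfI two_neq0).
  rewrite (contractC f v0 w) (cubicC12 f v0 w) -(prolongation_skew _ _ _ AE).
  by rewrite chiu fuv0; ring.
have prod0 v : f u v0 v * f u v v = 0.
  move: v; apply: (hessian_dense f_hess).
    by apply: polyfunM; apply: polyfun_cubic; try exact: vpolyfun_id;
      exact: vpolyfun_cst.
  move=> v dv; have [x xE] := hessian_surj (contract f u v0) dv.
  have xvE y : f x v y = f u v0 y by rewrite cubicC12 -!contractE xE.
  have skew w : chi w * f u v0 v = chi x * f w v v.
    apply/eqP; rewrite -subr_eq0; apply/eqP/(mulfI b_neq0).
    rewrite -xvE (prolongation_skew _ _ _ AE) xvE hu.
    by rewrite contractE (contractC f x v) xE subrr !mulr0.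
  have := skew u; rewrite chiu mul0r => /esym/eqP; rewrite mulf_eq0.
  case/orP => /eqP E; last by rewrite E mulr0.
  have [[w cw]|chi0] := pselect (exists w, chi w != 0).
    have /eqP := skew w; rewrite E mul0r mulf_eq0 (negPf cw) => /eqP ->.
    by rewrite mul0r.
  case/eqP: chi_neq0; apply/lfunP => w; rewrite zero_lfunE.
  by apply/eqP/negP => /negP cw; apply: chi0; exists w.
case/eqP: u_neq0; apply: (hessian_inj dv0) => x; rewrite cubicC12.
have P1 : polyfun (fun v => f u v0 v).
  by apply: polyfun_cubic; try exact: vpolyfun_id; exact: vpolyfun_cst.
have P2 : polyfun (fun v => f u v v).
  by apply: polyfun_cubic; try exact: vpolyfun_id; exact: vpolyfun_cst.
have [//|fu0] := polyfun_mul_eq0 P1 P2 prod0.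
apply: (quadratic_polarization (b := fun v x => f u v x)) => // [v w y|v w].
  exact: cubicDm.
exact: cubicC23.
Qed.

Hypothesis AE : prolongation_form 2^-1.

Lemma prolongation_symmetric l1 l2 : l1 (h l2) = l2 (h l1).
Proof.
have [v dv] := exists_hessian f_hess.
have [w1 <-] := hessian_surj l1 dv; have [w2 <-] := hessian_surj l2 dv.
rewrite !contractE !(cubicC12 f v) !(contractC f v).
apply/eqP; rewrite -subr_eq0; apply/eqP.
apply: (mulfI (_ : 2 != 0 :> C)); first by rewrite pnatr_eq0.
by rewrite -(prolongation_skew _ _ _ AE); field.
Qed.

(** This equals [2 h(f_ww) + chi(w) w]; the formula in terms of [A] makes it
    visibly a polynomial map. *)
Definition kernel_field w := 2 *: A w w - chi w *: w.

Lemma kernel_fieldE w : kernel_field w = 2 *: hh w w + chi w *: w.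
Proof.
rewrite /kernel_field AE -scalerDl !scalerDr scalerA addrAC addrC -scalerBl.
by congr (_ + _); congr (_ *: _); field.
Qed.

Lemma kernel_fieldZ t w : kernel_field (t *: w) = t ^+ 2 *: kernel_field w.
Proof.
rewrite /kernel_field !linearZ /= scale_lfunE scalerDr !scalerA.
by congr (_ *: _ + _ *: _); rewrite /GRing.scale /=; ring.
Qed.

Lemma vpolyfun_kernel_field : vpolyfun kernel_field.
Proof.
apply: (@vpolyfunD _ _ (fun w => 2 *: A w w) (fun w => - (chi w *: w))).
  apply: vpolyfunZ (polyfun_cst _ _) _.
  exact: vpolyfun_bilinear (@vpolyfun_id R W) (@vpolyfun_id R W).
move=> l; apply: (@polyfun_ext _ _ (fun w => -1 * (chi w * l w))) => [w|].
  by rewrite linearN linearZ mulN1r.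
apply: polyfunM (polyfun_cst _ _) _.
by apply: polyfunM; apply: polyfun_dual.
Qed.

Lemma cubic_kernel_field w x : 3 * f w (kernel_field w) x = - f w w w * chi x.
Proof.
have := prolongation_identity w w w x AE.
have -> : f w w (hh w x) = f w x (hh w w).
  by rewrite -!contractE prolongation_symmetric.
rewrite kernel_fieldE !cubicE (cubicC23 f w (hh w w)) => E.
by apply: (eq_lincomb1 (k := 2) E); field.
Qed.

Lemma cubic_kernel_field_cone w x : f w w w = 0 -> f w (kernel_field w) x = 0.
Proof.
move=> fw; apply: (mulfI (_ : 3 != 0 :> C)); first by rewrite pnatr_eq0.
by rewrite cubic_kernel_field fw oppr0 mul0r mulr0.
Qed.

Lemma cubic_kernel_field2_cone w x : f w w w = 0 ->
  f (kernel_field w) (kernel_field w) x = - chi (kernel_field w) * f w w x.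
Proof.
move=> fw; set z := kernel_field w.
have fwz y : f w z y = 0 by apply: cubic_kernel_field_cone.
have zE : z = 2 *: hh w w + chi w *: w := kernel_fieldE w.
clearbody z.
have := prolongation_identity w w z x AE.
have -> : contract f w z = 0.
  by apply/lfunP => y; rewrite contractE fwz zero_lfunE.
rewrite linear0 cubic0r !fwz (cubicC23 f w w z) fwz => E.
rewrite (cubicC23 f z z x) {2}zE !cubicE (cubicC13 f z x w).
rewrite (cubicC23 f w x z) fwz.
by apply: (eq_lincomb1 (k := 2) E); field.
Qed.

(** If [chi = 0], then [f(w, A_ww, _) = 0], so that [A_ww = 0] wherever the
    Hessian matrix is invertible. *)
Lemma prolongation_character_neq0 :
  A != 0 -> (forall u v, A u v = A v u) -> chi != 0.
Proof.
move=> A_neq0 AC; apply: contra_neq A_neq0 => chi0.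
have A0 l w : l (A w w) = 0.
  move: w; apply: (hessian_dense f_hess).
    exact: vpolyfun_bilinear (@vpolyfun_id R W) (@vpolyfun_id R W) l.
  move=> w dw; have : kernel_field w = 0.
    apply: (hessian_inj dw) => x; apply: (mulfI (_ : 3 != 0 :> C)).
      by rewrite pnatr_eq0.
    by rewrite cubic_kernel_field chi0 zero_lfunE !mulr0.
  rewrite /kernel_field chi0 zero_lfunE scale0r subr0 => /eqP.
  by rewrite scaler_eq0 pnatr_eq0 /= => /eqP ->; rewrite linear0.
apply/lfunP => u; apply/lfunP => v; rewrite !zero_lfunE.
apply/eqP/negP => /negP /separating_dual [l] /eqP []; move: u v.
apply: quadratic_polarization => [u v w|u v|w]; last exact: A0.
  by rewrite linearD add_lfunE linearD.
by rewrite AC.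
Qed.

(** If [chi (kernel_field w)] vanishes on the cone, it vanishes identically,
    being quadratic.  Then [c = h chi] satisfies
    [2 f(w, c, _) = - chi w *: chi], and [kernel_field w] and [c] have
    proportional images under [f_w]: this gives
    [3 chi(w) kernel_field(w) = 2 F(w) c], where [F w = f w w w], and so [F = 0]
    on the kernel of [chi]. *)
Lemma character_kernel_field_neq0 : chi != 0 ->
  ~ forall w, f w w w = 0 -> chi (kernel_field w) = 0.
Proof.
move=> chi_neq0 /(cone_vanishing_quadratic f_irr) H.
have {}H w : chi (kernel_field w) = 0.
  apply: H; first exact: vpolyfun_kernel_field.
  by move=> t u; rewrite kernel_fieldZ linearZ.
pose c := h chi.
have cE u v : 2 * f u v c + chi u * chi v = 0.
  move: u v; apply: quadratic_polarization => [u v w|u v|w].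
  - by rewrite cubicDl linearD /=; ring.
  - by rewrite cubicC12; ring.
  have := H w; rewrite kernel_fieldE linearD !linearZ /= => <-.
  by rewrite -contractE /c prolongation_symmetric.
have c_neq0 : c != 0.
  apply: contra_neq chi_neq0 => c0; apply/lfunP => u; have := cE u u.
  rewrite c0 cubic0r mulr0 add0r zero_lfunE => /eqP.
  by rewrite mulf_eq0 orbb => /eqP.
have [l lc] := separating_dual c_neq0.
have lE w : 3 * (chi w * l (kernel_field w)) + - 2 * (l c * f w w w) = 0.
  move: w; apply: (hessian_dense f_hess).
    repeat (apply: polyfunD || apply: polyfunM || apply: polyfun_cst
      || apply: polyfun_dual || apply: polyfun_cubic || exact: vpolyfun_id
      || exact: vpolyfun_kernel_field).
  move=> w dw; have : (3 * chi w) *: kernel_field w + (- 2 * f w w w) *: c = 0.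
    apply: (hessian_inj dw) => x; rewrite cubicDm !cubicZm.
    transitivity (chi w * (3 * f w (kernel_field w) x)
      - f w w w * (2 * f w c x)); first by ring.
    rewrite cubic_kernel_field (cubicC23 f w c).
    have /eqP := cE w x; rewrite addr_eq0 => /eqP ->; ring.
  move/(congr1 l); rewrite linear0 linearD !linearZ /= => <-.
  by rewrite /GRing.scale /=; ring.
apply: (irreducible_hyperplane f_irr chi_neq0) => w chiw.
have := lE w; rewrite chiw mul0r mulr0 add0r => /eqP.
by rewrite !mulf_eq0 oppr_eq0 pnatr_eq0 (negPf lc) => /eqP.
Qed.

End Prolongation.

(** * Secants of the singular locus *)

Section Secants.
Variables (R : realType) (W : vectType R[i]) (f : cubicForm W).
Local Notation C := R[i].
Implicit Types (c : C) (l : dual W) (q u v w x y z p : W) (g : W -> C).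

Lemma cubic_poly_homog : cubic_poly f \is 3.-homog.
Proof.
do 3![apply: rpred_sum => ? _]; apply: rpredZ.
rewrite -[3%N]/(1 + 1 + 1)%N; do 2?[apply: dhomogM];
  by rewrite dhomogX /= mdeg1.
Qed.

Definition line_point v (v_neq0 : v != 0) : projSpace W :=
  exist _ <[v]>%VS
    (introT eqP (etrans (dim_vline v) (congr1 nat_of_bool v_neq0))).

Lemma Sing_line_point v (v_neq0 : v != 0) :
  (forall x, f v v x = 0) -> Sing f (line_point v_neq0).
Proof.
move=> fv w /vlineP [k ->]; apply/cone_singularP => x.
by rewrite !cubicE fv !mulr0.
Qed.

Lemma secant_variety_sub L : secant_variety (Sing f) L -> hypersurface f L.
Proof.
move=> secL w wL; rewrite -cubic_polyE; apply: (secL 3 _ cubic_poly_homog) wL.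
move=> P [M [N [SM SN _ PMN]]] x /(subvP PMN) /memv_addP [u uM [v vN ->]].
have /cone_singularP fu := SM u uM; have /cone_singularP fv := SN v vN.
rewrite cubic_polyE !cubicE !fu !fv (cubicC23 f u v u) fu.
rewrite (cubicC13 f u v v) fv (cubicC13 f v u u) fu.
by rewrite (cubicC23 f v u v) fv !addr0.
Qed.

Hypothesis f_irr : irreducible_elt (cubic_poly f).

Lemma exists_gradient : exists x, ~ forall w, f w w w = 0 -> f w w x = 0.
Proof.
have [p fp] := exists_cubic_eq1 f_irr; exists p => f0.
have /eqP := fp; rewrite (cone_vanishing_quadratic f_irr _ _ f0).
- by rewrite eq_sym oner_eq0.
- by apply: polyfun_cubic; try exact: vpolyfun_id; exact: vpolyfun_cst.
- by move=> t w; rewrite !cubicE; ring.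
Qed.

(** The vectors [w + t z] and [w - t z] with [t ^+ 2 = c^-1] are singular, since
    [f_{w + sz, w + sz} = (1 - s ^+ 2 * c) f_ww]. *)
Lemma conic_secant (w z x : W) c : c != 0 -> f w w x != 0 -> z != 0 ->
  (forall y, f w z y = 0) -> (forall y, f z z y = - c * f w w y) ->
  forall d (G : {mpoly C[_]}), G \is d.-homog ->
  (forall M, [set L | exists M N : projSpace W,
    [/\ Sing f M, Sing f N, M != N & (val L <= val M + val N)%VS]]%classic M ->
    vanishes_at G M) -> G.@[coordinates w] = 0.
Proof.
move=> c_neq0 fwwx z_neq0 fwz fzz d G _ GP.
have [t tE] : exists t, t ^+ 2 = c^-1 by exists (sqrtC c^-1); rewrite sqrtCK.
have t_neq0 : t != 0.
  by apply: contra_eq_neq tE => ->; rewrite expr0n eq_sym invr_eq0.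
have fzw y : f z w y = 0 by rewrite cubicC12.
have sing s : s ^+ 2 = c^-1 -> forall y, f (w + s *: z) (w + s *: z) y = 0.
  move=> sE y; rewrite !cubicE fwz fzw fzz.
  transitivity ((1 - s ^+ 2 * c) * f w w y); first by ring.
  by rewrite sE mulVf // subrr mul0r.
have pair_w s : f w (w + s *: z) x = f w w x.
  by rewrite !cubicE fwz mulr0 addr0.
have sing_neq0 s : w + s *: z != 0.
  by apply: contraNneq fwwx => ws0; rewrite -(pair_w s) ws0 cubic0m.
have w_neq0 : w != 0 by apply: contraNneq fwwx => ->; rewrite cubic0m.
have negtE : (- t) ^+ 2 = c^-1 by rewrite sqrrN.
apply: (GP (line_point w_neq0)); last exact: memv_line.
exists (line_point (sing_neq0 t)), (line_point (sing_neq0 (- t))); split.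
- exact/Sing_line_point/sing.
- exact/Sing_line_point/sing.
- apply/negP => /eqP /(congr1 val) /= E.
  have : w + - t *: z \in <[w + t *: z]>%VS by rewrite E memv_line.
  case/vlineP => k kE; have k1 : k = 1.
    apply: (mulIf fwwx); rewrite mul1r -{1}(pair_w t) -cubicZm -kE.
    exact: pair_w.
  move: kE; rewrite k1 scale1r => /addrI /eqP.
  rewrite scaleNr eq_sym -addr_eq0 -scalerDl scaler_eq0 (negPf z_neq0) orbF.
  by rewrite -mulr2n mulrn_eq0 (negPf t_neq0).
- rewrite /= -memvE.
  have wE : w = 2^-1 *: (w + t *: z) + 2^-1 *: (w + - t *: z).
    rewrite -scalerDr addrACA -scalerDl subrr scale0r addr0 -mulr2n.
    by rewrite -[w *+ 2]scaler_nat scalerA mulVf ?scale1r ?pnatr_eq0.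
  by rewrite {1}wE; apply: memv_add; apply: memvZ; apply: memv_line.
Qed.

Lemma is_character_unique phi c c' :
  is_character f phi c -> is_character f phi c' -> c = c'.
Proof.
move=> phi_c phi_c'; have [p fp] := exists_cubic_eq1 f_irr.
by have := phi_c p p p; rewrite phi_c' fp !mulr1.
Qed.

(** The character is unique because the cubic is nonzero, so the characters on a
    basis determine it linearly. *)
Lemma character_linear (A : 'Hom(W, 'End(W))) : (forall w, aut_cone f (A w)) ->
  exists2 chi : dual W, forall w, is_character f (A w) (chi w)
    & forall w, character f (A w) = chi w.
Proof.
move=> Aaut; have Achar w : is_character f (A w) (character f (A w)).
  exact: (xgetPex 0 (aut_cone_character f_irr (Aaut w))).
pose chi : dual W := \sum_(i < \dim {:W})
  character f (A (vbasis {:W})`_i) *: coordinate_form i.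
have chiP w : is_character f (A w) (chi w).
  rewrite {1}(coordinatesE w) linear_sum sum_lfunE.
  apply: (big_ind2 (fun phi c => is_character f phi c))
    => [u v x|phi c psi c' Hphi Hpsi u v x|i _ u v x].
  - by rewrite !zero_lfunE cubic0r cubic0m cubicC13 cubic0r mul0r !addr0.
  - rewrite !add_lfunE !cubicE mulrDl -Hphi -Hpsi; ring.
  rewrite linearZ /= !scale_lfunE !cubicE coordinate_formE -!mulrDr Achar.
  by rewrite /GRing.scale /=; ring.
by exists chi => // w; apply: is_character_unique (Achar w) (chiP w).
Qed.

End Secants.

Theorem theorem5p1 (R : realType) (W : vectType R[i]) (f : cubicForm W)
    (f_irr : irreducible_elt (cubic_poly f)) (f_hess : nonzero_hessian f)
    (HA : exists (A : 'Hom(W, 'End(W))) (h : 'Hom(dual W, W)) (a : R[i]),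
       [/\ A != 0, aut_prolongation f A, a != 4^-1 &
           forall u v : W,
             A u v = (a * character f (A u)) *: v
                     + (a * character f (A v)) *: u + h (contract f u v)]) :
  secant_variety (Sing f) = hypersurface f.
Proof.
have [A [h [a [A_neq0 [AC Aaut] _ AE]]]] := HA.
have [chi chiP chiE] : exists2 chi : dual W,
    forall w, is_character f (A w) (chi w)
    & forall w, character f (A w) = chi w.
  exact: character_linear.
(* For chi = 0 the scalar a has no influence on A. *)
have {}AE : prolongation_form f A h chi 2^-1.
  have AE0 : prolongation_form f A h chi a by move=> u v; rewrite AE !chiE.
  have [chi0|chi_neq0] := eqVneq chi 0.
    by move=> u v; rewrite AE0 chi0 !zero_lfunE !mulr0.
  by rewrite -(prolongation_coef f_irr f_hess chiP AE0 chi_neq0).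
have chi_neq0 := prolongation_character_neq0 f_hess chiP AE A_neq0 AC.
apply/seteqP; split=> L; first exact: secant_variety_sub.
move=> YL d G G_homog G_sec w wL.
have [x fx] := exists_gradient f_irr.
have PG : polyfun (fun w : W => G.@[coordinates w]) by exists G.
have Pz : polyfun (fun w => chi (kernel_field A chi w)) :=
  vpolyfun_kernel_field A chi chi.
have Pf : polyfun (fun w => f w w x).
  by apply: polyfun_cubic; try exact: vpolyfun_id; exact: vpolyfun_cst.
have [u fu||zero_] := cone_irreducible f_irr PG (polyfunM Pz Pf).
- set z := kernel_field A chi u.
  have [->|cz] := eqVneq (chi z) 0; first by rewrite mul0r mulr0.
  (* Away from the singular points, so that both points of the secant are
     nonzero. *)
  have [->|fux] := eqVneq (f u u x) 0; first by rewrite !mulr0.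
  have -> : G.@[coordinates u] = 0; last by rewrite mul0r.
  apply: (@conic_secant _ _ f u z x _ cz fux _ _ _ d G G_homog G_sec).
  + by apply: contraNneq cz => ->; rewrite linear0.
  + by move=> y; apply: cubic_kernel_field_cone.
  + by move=> y; apply: cubic_kernel_field2_cone.
- by apply; apply: YL.
have [//||] := cone_irreducible f_irr Pz Pf.
- by move=> /(character_kernel_field_neq0 f_irr f_hess chiP AE chi_neq0).
- by move=> /fx.
Qed.
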